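(* Let $k$ and $n$ be positive integers. Then $$2S_{2k+1}(n)\equiv -(2k+1)\,n\sum_{\substack{p \text{ prime}\\ (p-1)\mid 2k,\ p\mid n}}\frac{n}{p}\pmod{n^2},$$ where the summation is taken over all primes $p$ such that $(p-1)\mid 2k$ and $p\mid n$.
   Context: For integers $k\ge 1$ and $n\ge 1$, $S_k(n):=\sum_{i=1}^{n-1} i^k$ (empty sum $=0$ for $n=1$). An empty sum over primes is $0$. *)

(* Defs.v *)
From mathcomp Require Import all_boot all_order all_algebra.

Set Implicit Arguments.
Unset Strict Implicit.
Unset Printing Implicit Defensive.

Definition power_sum (k n : nat) : nat := (\sum_(1 <= i < n) i ^ k)%N.

(* The bound p <= n loses no prime, as p divides n > 0; the truncated quotient
   n %/ p is the exact one, as p divides n. *)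
Definition prime_quotient_sum (k n : nat) : nat :=
  (\sum_(1 <= p < n.+1 | [&& prime p, p.-1 %| 2 * k & p %| n]) n %/ p)%N.

(* Main.v *)
Require Import Defs.
From mathcomp Require Import all_boot all_order all_algebra all_field.
From mathcomp Require Import ring zify.
Import GRing.Theory.
Local Open Scope ring_scope.

(** Write S_m(n) for [power_sum m n].

    Pairing i with n - i and expanding (n - i)^(2k+1) to first order in n gives
    2 S_(2k+1)(n) = (2k+1) n S_(2k)(n) modulo n^2 ([double_odd_power_sum]).
    The theorem therefore follows from a von Staudt-type congruence one power of
    n lower: S_(2k)(n) + sum of n/p = 0 modulo n
    ([even_power_sum_mod]), which can be checked at each prime power q = p^a
    exactly dividing n.

    The tool for that is the comparison of S_(2k)(nd) with d S_(2k)(n).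
    Cutting the range of summation into d blocks of length n and expanding to
    first order in n, the linear terms add up to
    2k n (0 + 1 + ... + (d-1)) S_(2k-1)(n) = k n d (d-1) S_(2k-1)(n);
    the evenness of the exponent is what cancels the denominator 2
    ([even_power_sum_mul]). Hence
    - S_(2k)(qr) = r S_(2k)(q) modulo q, which reduces n to q;
    - S_(2k)(p^(a+1)) = p S_(2k)(p^a) modulo p^(a+1) for a > 0, which reduces q to p.
    For n = p, the sum is that of x^(2k) over the field with p elements, namely
    -1 if p - 1 divides 2k and 0 otherwise ([sum_finField_expr]). Multiplying
    back by p^(a-1) n/q, this value becomes -n/p, which is the term of p in the
    sum over primes; the terms of the other primes vanish modulo q. *)

(** * First-order expansions of power sums *)

Lemma dvdz_exprD_linear (x y : int) (m : nat) :
  (y ^+ 2 %| (x + y) ^+ m.+1 - (x ^+ m.+1 + m.+1%:Z * x ^+ m * y))%Z.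
Proof.
elim: m => [|m IHm]; first by apply/dvdzP; exists 0; ring.
have -> : (x + y) ^+ m.+2 - (x ^+ m.+2 + m.+2%:Z * x ^+ m.+1 * y) =
    (x + y) * ((x + y) ^+ m.+1 - (x ^+ m.+1 + m.+1%:Z * x ^+ m * y)) +
    (m.+1%:Z * x ^+ m) * y ^+ 2.
  have -> : m.+2%:Z = m.+1%:Z + 1 by lia.
  by rewrite !exprS; ring.
by apply: rpredD; apply: dvdz_mull.
Qed.

(** Starting the sum at 0 makes the range a full set of residues, which suits
    both the cutting into blocks and the comparison with a finite field. *)
Lemma natr_power_sum (R : nzSemiRingType) (m n : nat) : (0 < m)%N ->
  (power_sum m n)%:R = \sum_(0 <= i < n) i%:R ^+ m :> R.
Proof.
move=> m_gt0; rewrite /power_sum natr_sum.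
case: n => [|n]; first by rewrite !big_geq.
rewrite [RHS]big_ltn // expr0n eqn0Ngt m_gt0 add0r.
by apply: eq_bigr => i _; rewrite natrX.
Qed.

Lemma power_sumE (m n : nat) : (0 < m)%N ->
  (power_sum m n)%:Z = \sum_(0 <= i < n) i%:Z ^+ m.
Proof.
move=> m_gt0; rewrite -natz natr_power_sum //.
by apply: eq_bigr => i _; rewrite natz.
Qed.

(** Add the sum to its own reversal: i^(m+1) + (n - i)^(m+1) reduces to
    (m+1) n i^m modulo n^2, since m + 1 is odd. *)
Lemma double_odd_power_sum (m n : nat) : (0 < m)%N -> ~~ odd m ->
  (n%:Z ^+ 2 %| 2%:Z * (power_sum m.+1 n)%:Z
                - m.+1%:Z * n%:Z * (power_sum m n)%:Z)%Z.
Proof.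
move=> m_gt0 m_even; rewrite /power_sum -!natz !natr_sum !natz.
rewrite (_ : 2%:Z = 1 + 1) // mulrDl mul1r {1}big_nat_rev /=.
rewrite -big_split /= mulr_sumr -sumrB big_nat.
apply: rpred_sum => i /andP[_ lt_in].
rewrite add1n subSS !natrX !natz.
have -> : (n - i)%N%:Z = - i%:Z + n%:Z by lia.
have := dvdz_exprD_linear (- i%:Z) n%:Z m.
rewrite !(exprNn i%:Z) -(signr_odd _ m) -(signr_odd _ m.+1) /=.
rewrite (negPf m_even) expr0 expr1 => expansion.
by apply: etrans expansion; congr (_ %| _)%Z; ring.
Qed.

(** Induction on the number d of blocks: the block [nd, n(d+1)) contributes
    S_(2k)(n) + 2k nd S_(2k-1)(n) modulo n^2, and k n d (d-1) grows by 2k nd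
    when d becomes d + 1. *)
Lemma even_power_sum_mul (k n d : nat) : (0 < k)%N ->
  (n%:Z ^+ 2 %| (power_sum (2 * k) (n * d))%:Z
     - (d%:Z * (power_sum (2 * k) n)%:Z
        + k%:Z * n%:Z * d%:Z * (d%:Z - 1)
          * (power_sum (2 * k).-1 n)%:Z))%Z.
Proof.
case: k => // k _; rewrite mulnS /= !power_sumE //.
set m := (2 * k)%N.
elim: d => [|d IHd].
  by rewrite muln0 big_geq //; apply/dvdzP; exists 0; ring.
rewrite mulnS addnC (big_cat_nat (leq0n (n * d))) ?leq_addr //=.
rewrite -{2}[(n * d)%N]add0n big_addn addKn.
set S := \sum_(0 <= i < n * d) _ in IHd *.
set T := \sum_(0 <= i < n) i%:Z ^+ m.+2 in IHd *.
set U := \sum_(0 <= i < n) i%:Z ^+ m.+1 in IHd *.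
have block : (n%:Z ^+ 2 %| \sum_(0 <= i < n) (i + n * d)%N%:Z ^+ m.+2
    - (T + m.+2%:Z * U * (n * d)%N%:Z))%Z.
  rewrite /T /U mulr_sumr mulr_suml -big_split -sumrB.
  apply: rpred_sum => i _; rewrite PoszD PoszM.
  apply: dvdz_trans (dvdz_exprD_linear _ _ _).
  by rewrite exprMn dvdz_mulr.
apply: etrans (rpredD IHd block); congr (_ %| _)%Z.
have -> : m.+2%:Z = 2 * k.+1%:Z by rewrite /m; lia.
by rewrite PoszM -(addn1 d) PoszD; ring.
Qed.

(** * Power sums over a finite field *)

(** Translation by 1 permutes F, so it does not change the sum of the elements
    of F, but it adds #|F| to it. *)
Lemma finField_natr_card (F : finFieldType) : #|F|%:R = 0 :> F.
Proof.
have : \sum_(x : F) (x + 1) = \sum_(x : F) x.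
  by rewrite [RHS](reindex_inj (addIr 1)).
by rewrite big_split /= sumr_const => /(canRL (addKr _)); rewrite addNr.
Qed.

(** If #|F| - 1 divides m, all nonzero x contribute 1. Otherwise some nonzero g
    has g^m different from 1, and the sum, being invariant under multiplication
    by g^m, vanishes. *)
Lemma sum_finField_expr (F : finFieldType) (m : nat) : (0 < m)%N ->
  \sum_(x : F) x ^+ m = if (#|F|.-1 %| m)%N then -1 else 0.
Proof.
move=> m_gt0; have cardF := finNzRing_gt1 F.
have unitX (x : F) : x != 0 -> x ^+ #|F|.-1 = 1.
  move=> nz_x; apply: (mulfI nz_x).
  by rewrite -exprS prednK ?(ltnW cardF) // expf_card mulr1.
case: ifPn => [/dvdnP[e Em]|ndvd].
  rewrite (bigD1 0) //= expr0n (gtn_eqF m_gt0) add0r.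
  rewrite (eq_bigr (fun=> 1)) => [|x nz_x]; last first.
    by rewrite Em mulnC exprM unitX ?expr1n.
  rewrite sumr_const cardC1; apply/eqP; rewrite -addr_eq0.
  by rewrite natr1 prednK ?(ltnW cardF) // finField_natr_card.
have [g /andP[nz_g gm]] : exists g : F, (g != 0) && (g ^+ m != 1).
  apply/existsP; apply: contraNT ndvd; rewrite negb_exists => /forallP all1.
  (* With r the remainder of m, the #|F| - 1 nonzero elements would all be
     roots of 'X^r - 1, whose degree r is smaller. *)
  rewrite /dvdn; set r := (m %% _)%N.
  have r_lt : (r < #|F|.-1)%N by rewrite ltn_mod -subn1 subn_gt0.
  case: (posnP r) => // r_gt0.
  have sz := size_XnsubC (1 : F) r_gt0.
  have : (#|predC1 (0%R : F)| < size ('X^r - 1%:P : {poly F})%R)%N.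
    rewrite cardE; apply: max_poly_roots (enum_uniq _).
      by rewrite -size_poly_eq0 sz.
    apply/allP => x; rewrite mem_enum inE => nz_x.
    rewrite rootE !hornerE subr_eq0.
    have := all1 x; rewrite nz_x negbK /= {1}(divn_eq m #|F|.-1) -/r.
    by rewrite exprD mulnC exprM unitX // expr1n mul1r.
  by rewrite cardC1 sz ltnS leqNgt r_lt.
have : (g ^+ m - 1) * (\sum_(x : F) x ^+ m) = 0.
  rewrite mulrBl mul1r mulr_sumr [X in _ - X](reindex_inj (mulfI nz_g)).
  by apply/eqP; rewrite subr_eq0; apply/eqP/eq_bigr => x _; rewrite exprMn.
by move/eqP; rewrite mulf_eq0 subr_eq0 (negPf gm) => /eqP.
Qed.

(** * Even power sums modulo n *)

Lemma prime_power_sum (p m : nat) : prime p -> (0 < m)%N ->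
  (p %| power_sum m p + (p.-1 %| m))%N.
Proof.
move=> p_pr m_gt0.
rewrite (dvdn_pcharf (pchar_Fp p_pr)) natrD.
have := @sum_finField_expr 'F_p m m_gt0; rewrite card_Fp // => sumF.
have -> : (power_sum m p)%:R = \sum_(x : 'F_p) x ^+ m.
  (* The carrier of 'F_p is an ordinal type whose bound equals p only
     propositionally; rewriting the range of the sum leaves the type alone. *)
  have range_p : index_iota 0 p = index_iota 0 (Zp_trunc (pdiv p)).+2.
    by rewrite Fp_cast.
  rewrite natr_power_sum // range_p big_mkord.
  by apply: eq_bigr => i _; rewrite natr_Zp.
by rewrite sumF; case: (_ %| _)%N; rewrite ?addNr ?addr0.
Qed.

(** Pass from p^(a+1) to p^(a+2) by [even_power_sum_mul] with n = p^(a+1) and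
    d = p: the modulus n^2 is a multiple of p^(a+2) = nd, and so is the
    correction k n d (d-1) S_(2k-1)(n). *)
Lemma prime_pow_power_sum (k p a : nat) : prime p -> (0 < k)%N ->
  (p ^ a.+1 %| power_sum (2 * k) (p ^ a.+1) + (p.-1 %| 2 * k) * p ^ a)%N.
Proof.
move=> p_pr k_gt0; elim: a => [|a IHa].
  by rewrite expn1 muln1 prime_power_sum // muln_gt0.
have := even_power_sum_mul k (p ^ a.+1) p k_gt0; rewrite -expnSr => lift.
set b := (p.-1 %| 2 * k)%N in IHa *.
have modulus : ((p ^ a.+2)%:Z %| (p ^ a.+1)%:Z ^+ 2)%Z.
  by rewrite dvdzE abszX /= -expnM dvdn_exp2l //; lia.
have {lift modulus} lift := dvdz_trans modulus lift.
have scaled : ((p ^ a.+2)%:Z %|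
    p%:Z * (power_sum (2 * k) (p ^ a.+1) + b * p ^ a)%N%:Z)%Z.
  rewrite (expnS p a.+1) (PoszM p (p ^ a.+1)%N).
  exact: dvdz_mul (dvdzz _) (IHa : (Posz _ %| Posz _)%Z).
have correction : ((p ^ a.+2)%:Z %|
    k%:Z * (p ^ a.+1)%:Z * p%:Z * (p%:Z - 1)
    * (power_sum (2 * k).-1 (p ^ a.+1))%:Z)%Z.
  rewrite (expnSr p a.+1) (PoszM (p ^ a.+1)%N p); apply/dvdzP.
  by exists (k%:Z * (p%:Z - 1) * (power_sum (2 * k).-1 (p ^ a.+1))%:Z); ring.
suff : ((p ^ a.+2)%:Z %|
    (power_sum (2 * k) (p ^ a.+2) + b * p ^ a.+1)%N%:Z)%Z by [].
apply: etrans (rpredD (rpredD lift scaled) correction); congr (_ %| _)%Z.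
rewrite !PoszD; have -> : (b * p ^ a.+1)%N%:Z = p%:Z * (b * p ^ a)%N%:Z.
  by rewrite expnS mulnCA PoszM.
ring.
Qed.

(** Work modulo the exact power q = p^(a+1) of each prime p dividing n = qr. In
    the sum over primes only the term n/p = p^a r of p survives modulo q, and
    S_(2k)(qr) = r S_(2k)(q), so the congruence is r times the one for q. *)
Lemma even_power_sum_mod (k n : nat) : (0 < k)%N -> (0 < n)%N ->
  (n %| power_sum (2 * k) n + prime_quotient_sum k n)%N.
Proof.
move=> k_gt0 n_gt0; apply/(dvdn_partP _ n_gt0) => p.
rewrite mem_primes => /and3P[p_pr _ p_dvd_n].
have loc := prime_pow_power_sum k p (logn p n).-1 p_pr k_gt0.
have log_gt0 : (0 < logn p n)%N by rewrite logn_gt0 mem_primes p_pr n_gt0.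
have n_eq : (n = p ^ (logn p n).-1.+1 * n`_p^')%N.
  by rewrite prednK // -p_part partnC.
rewrite p_part -(prednK log_gt0).
set a := (logn p n).-1 in loc n_eq *; set r := (n`_p^')%N in n_eq.
have n_div_p : (n %/ p = p ^ a * r)%N.
  by rewrite {1}n_eq expnS -mulnA mulKn ?prime_gt0.
have others : (p ^ a.+1 %| \sum_(1 <= l < n.+1 |
    [&& prime l, l.-1 %| 2 * k & l %| n] && (l != p)) n %/ l)%N.
  apply: dvdn_sum => l /andP[/and3P[l_pr _ l_dvd_n] l_ne_p].
  have cop : coprime (p ^ a.+1) l.
    by rewrite coprime_pexpl // prime_coprime // dvdn_prime2 // eq_sym.
  rewrite -(Gauss_dvdr _ cop) mulnC divnK //.
  by rewrite [X in (_ %| X)%N]n_eq dvdn_mulr.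
have -> : (prime_quotient_sum k n = (p.-1 %| 2 * k) * (p ^ a * r)
    + \sum_(1 <= l < n.+1 |
        [&& prime l, l.-1 %| 2 * k & l %| n] && (l != p)) n %/ l)%N.
  rewrite /prime_quotient_sum (bigID (pred1 p)) /= big_nat1_cond_eq.
  rewrite prime_gt0 // ltnS dvdn_leq //= p_pr p_dvd_n andbT n_div_p.
  by case: (_ %| 2 * k)%N; rewrite ?mul1n ?mul0n.
rewrite addnA dvdn_addl //.
have := even_power_sum_mul k (p ^ a.+1) r k_gt0; rewrite -n_eq => mult.
set b := (p.-1 %| 2 * k)%N in loc *.
have {mult} /(dvdz_trans (dvdz_exp (isT : 0 < 2)%N (dvdzz _))) mult := mult.
have scaled : ((p ^ a.+1)%:Z %|
    r%:Z * (power_sum (2 * k) (p ^ a.+1) + b * p ^ a)%N%:Z)%Z.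
  by rewrite dvdz_mull.
have correction : ((p ^ a.+1)%:Z %|
    k%:Z * (p ^ a.+1)%:Z * r%:Z * (r%:Z - 1)
    * (power_sum (2 * k).-1 (p ^ a.+1))%:Z)%Z.
  by rewrite [k%:Z * _]mulrC !dvdz_mulr.
suff : ((p ^ a.+1)%:Z %|
    (power_sum (2 * k) n + b * (p ^ a * r))%N%:Z)%Z by [].
apply: etrans (rpredD (rpredD mult scaled) correction); congr (_ %| _)%Z.
by rewrite !PoszD !PoszM; ring.
Qed.

Theorem theorem2p21 (k n : nat) (hk : (0 < k)%N) (hn : (0 < n)%N) :
  (2%:Z * (power_sum (2 * k + 1)%N n)%:Z
     = - ((2 * k + 1)%N%:Z * n%:Z * (prime_quotient_sum k n)%:Z)
     %[mod n%:Z ^+ 2])%Z.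
Proof.
apply/eqP; rewrite eqz_mod_dvd addn1.
have /dvdnP[c Hc] := even_power_sum_mod k n hk hn.
have := double_odd_power_sum (2 * k) n; rewrite muln_gt0 hk oddM.
move=> /(_ isT isT) paired.
have multiple : (n%:Z ^+ 2 %| (2 * k).+1%:Z * n%:Z
    * (power_sum (2 * k) n + prime_quotient_sum k n)%N%:Z)%Z.
  by rewrite Hc PoszM; apply/dvdzP; exists ((2 * k).+1%:Z * c%:Z); ring.
apply: etrans (rpredD paired multiple); congr (_ %| _)%Z.
by rewrite PoszD; ring.
Qed.
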